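(* For $t\in\{\mathrm{i},\mathrm{f}\}$, when $\alpha_{\mathrm{F}}>\bar\gamma_t^{\mathrm{F}}\alpha_{\mathrm{N}}$, the diversity orders of the near user and the far user are $2$ and $1$, respectively, in both NOMA-ISAC ($t=\mathrm{i}$) and NOMA-FDSAC ($t=\mathrm{f}$).
   Context: A base station serves two users by nonorthogonal multiple access (NOMA). Let $h_1\sim\mathcal{CN}(0,\varrho_1)$ and $h_2\sim\mathcal{CN}(0,\varrho_2)$ be mutually independent complex Gaussian random variables with $\varrho_1>0$, $\varrho_2>0$. The near user (N) and the far user (F) have channel coefficients with $|h_{\mathrm{N}}|=\max\{|h_1|,|h_2|\}$ and $|h_{\mathrm{F}}|=\min\{|h_1|,|h_2|\}$. Let $p$ be the power budget, $\sigma_{\mathrm{c}}^2$ the communication noise variance, and $\alpha_{\mathrm{N}},\alpha_{\mathrm{F}}$ power allocation factors with $\alpha_{\mathrm{N}}+\alpha_{\mathrm{F}}=1$ and $\alpha_{\mathrm{N}}<\alpha_{\mathrm{F}}$. The index $t=\mathrm{i}$ denotes integrated sensing and communications (ISAC), with $\kappa_{\mathrm{i}}=\mu_{\mathrm{i}}=1$; the index $t=\mathrm{f}$ denotes frequency-division sensing and communications (FDSAC), with $\kappa_{\mathrm{f}}=\kappa$ and $\mu_{\mathrm{f}}=\mu$, where $\kappa\in[0,1]$ and $\mu\in[0,1]$ are the fractions of the bandwidth and of the power used for communications. Define $$\gamma_t^{\mathrm{sic}}=\frac{\mu_t p|h_{\mathrm{N}}|^2\alpha_{\mathrm{F}}}{\kappa_t\sigma_{\mathrm{c}}^2+\mu_t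 p|h_{\mathrm{N}}|^2\alpha_{\mathrm{N}}},\quad \gamma_t^{\mathrm{N}}=\frac{\mu_t p|h_{\mathrm{N}}|^2\alpha_{\mathrm{N}}}{\kappa_t\sigma_{\mathrm{c}}^2},\quad \gamma_t^{\mathrm{F}}=\frac{\mu_t p|h_{\mathrm{F}}|^2\alpha_{\mathrm{F}}}{\kappa_t\sigma_{\mathrm{c}}^2+\mu_t p|h_{\mathrm{F}}|^2\alpha_{\mathrm{N}}}.$$ Let $\overline{\mathcal{R}}_{\mathrm{N}}$ and $\overline{\mathcal{R}}_{\mathrm{F}}$ be the target rates of the near and far users, and set $\bar\gamma_t^{\mathrm{N}}=2^{\overline{\mathcal{R}}_{\mathrm{N}}/\kappa_t}-1$, $\bar\gamma_t^{\mathrm{F}}=2^{\overline{\mathcal{R}}_{\mathrm{F}}/\kappa_t}-1$. The outage probabilities of the near and far users are $$\mathcal{P}_t^{\mathrm{N}}=1-\Pr\left(\gamma_t^{\mathrm{sic}}>\bar\gamma_t^{\mathrm{F}},\ \gamma_t^{\mathrm{N}}>\bar\gamma_t^{\mathrm{N}}\right),\qquad \mathcal{P}_t^{\mathrm{F}}=\Pr\left(\gamma_t^{\mathrm{F}}<\bar\gamma_t^{\mathrm{F}}\right).$$ The diversity order of a user with outage probability $\mathcal{P}$ is $-\lim_{p\to\infty}\frac{\log\mathcal{P}}{\log p}$, with all other parameters fixed.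
   Formalization: Assumes the communication bandwidth and power fractions are positive (at κ=0 thresholds are undefined; at μ=0 both outages equal 1), and also σ_c²>0, α_N>0, near-user target rate ≥0 and far-user target rate >0, since otherwise an outage is constantly 1 or 0 or the setting is meaningless. *)

(* Defs.v *)
From mathcomp Require Import all_boot all_order all_algebra.
From mathcomp Require Import all_classical all_reals all_analysis.
From mathcomp Require Import complex.
Import Order.TTheory GRing.Theory Num.Theory.
Import numFieldNormedType.Exports.

Set Implicit Arguments.
Unset Strict Implicit.
Unset Printing Implicit Defensive.

Local Open Scope classical_set_scope.
Local Open Scope ring_scope.

Section ComplexGaussian.
Context {d : measure_display} {T : measurableType d} {R : realType}.
Variable P : probability T R.
Implicit Types h : T -> R[i].

(* The library puts no sigma-algebra on R[i]; the Borel structure of the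
   complex plane is that of R * R. *)
Definition cplane h (w : T) : R * R := (complex.Re (h w), complex.Im (h w)).

(* h ~ CN(0, rho): the real and imaginary parts of h are independent and
   N(0, rho / 2).  The second parameter of normal_prob is the standard
   deviation, not the variance. *)
Definition complex_gaussian (rho : R) h : Prop :=
  measurable_fun setT (cplane h) /\
  forall A : set (R * R), measurable A ->
    P (cplane h @^-1` A) =
    (normal_prob (0 : R) (Num.sqrt (rho / 2)) \x
     normal_prob (0 : R) (Num.sqrt (rho / 2)))%E A.

Definition independent h1 h2 : Prop :=
  forall A B : set (R * R), measurable A -> measurable B ->
    P (cplane h1 @^-1` A `&` cplane h2 @^-1` B) =
    (P (cplane h1 @^-1` A) * P (cplane h2 @^-1` B))%E.

End ComplexGaussian.

Section NOMA.
Context {R : realType}.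

Inductive scheme := ISAC | FDSAC.

(* kappa_t and mu_t, given the FDSAC fractions kappa and mu. *)
Definition bandwidth (t : scheme) (kappa : R) : R :=
  if t is FDSAC then kappa else 1.
Definition power (t : scheme) (mu : R) : R :=
  if t is FDSAC then mu else 1.

(* Below, k = kappa_t, m = mu_t, sigma2 is the noise variance, aN and aF are
   the power allocation factors and h is the relevant channel coefficient. *)
Definition sqmod (h : R[i]) : R := Normc.normc h ^+ 2.

Definition gamma_sic (k m sigma2 aN aF p : R) (h : R[i]) : R :=
  (m * p * sqmod h * aF) / (k * sigma2 + m * p * sqmod h * aN).

Definition gamma_N (k m sigma2 aN p : R) (h : R[i]) : R :=
  (m * p * sqmod h * aN) / (k * sigma2).

Definition gamma_F (k m sigma2 aN aF p : R) (h : R[i]) : R :=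
  (m * p * sqmod h * aF) / (k * sigma2 + m * p * sqmod h * aN).

Definition threshold (k rate : R) : R := 2 `^ (rate / k) - 1.

Context {d : measure_display} {T : measurableType d}.
Variable P : probability T R.

Definition outage_near (k m sigma2 aN aF RN RF : R) (hN : T -> R[i]) (p : R)
    : R :=
  1 - fine (P [set w | gamma_sic k m sigma2 aN aF p (hN w) > threshold k RF /\
                       gamma_N k m sigma2 aN p (hN w) > threshold k RN]).

Definition outage_far (k m sigma2 aN aF RF : R) (hF : T -> R[i]) (p : R) : R :=
  fine (P [set w | gamma_F k m sigma2 aN aF p (hF w) < threshold k RF]).

End NOMA.

(* The outage probability Pout, as a function of the power budget p, has
   diversity order D: the limit exists and equals D. *)
Definition has_diversity_order {R : realType} (Pout : R -> R) (D : R) : Prop :=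
  - (ln (Pout p) / ln p) @[p --> +oo] --> D.

(* Main.v *)
Require Import Defs.
From mathcomp Require Import all_boot all_order all_algebra.
From mathcomp Require Import all_classical all_reals all_analysis.
From mathcomp Require Import measurable_realfun complex ring lra.
Import Order.TTheory GRing.Theory Num.Theory.
Import numFieldNormedType.Exports.
Local Open Scope ring_scope.

(** Each SINR or SNR condition of a user at power [p] amounts to comparing its
    squared channel gain with a constant over [p].  Hence the near user is in
    outage exactly when both [|h1|^2] and [|h2|^2] are at most [c / p], the far
    user exactly when one of them is below [cF / p].  A complex Gaussian has
    density bounded above, and bounded below near the origin, so
    [Pr (|h|^2 <= x)] lies between two positive multiples of [x] for
    [0 < x <= 1]; the two outage probabilities are therefore of exact order
    [p ^- 2] (by independence) and [p ^- 1]. *)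

Local Open Scope classical_set_scope.

(** * Diversity order from two-sided power-law bounds *)

Lemma cvg_ln_pinfty (R : realType) : ln (p : R) @[p --> +oo] --> +oo.
Proof.
apply/cvgryPge => A; near=> p.
have pA : expR A <= p by near: p; exact: nbhs_pinfty_ge.
by rewrite -(expRK A) ler_ln ?posrE ?expR_gt0// (lt_le_trans _ pA)// expR_gt0.
Unshelve. all: by end_near. Qed.

(** For any constant [c > 0], [- ln (c / p ^+ n) / ln p] equals [n - ln c / ln p], whose limit [n]
    does not depend on [c]; hence bounds matching only up to constants already fix the exponent. *)
Lemma diversity_order_squeeze (R : realType) (Pout : R -> R) (n : nat)
    (a b : R) : 0 < a -> 0 < b ->
  (\forall p \near +oo, a / p ^+ n <= Pout p <= b / p ^+ n) ->
  has_diversity_order Pout n%:R.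
Proof.
move=> a0 b0 Pab; rewrite /has_diversity_order.
have lnV0 : (ln (p : R))^-1 @[p --> +oo] --> 0.
  apply/gtr0_cvgV0; last exact: cvg_ln_pinfty.
  by near=> p; rewrite ln_gt0//; near: p; exact: nbhs_pinfty_gt.
have lim (c : R) : n%:R - ln c * (ln p)^-1 @[p --> +oo] --> (n%:R : R).
  rewrite -[X in _ --> X]subr0 -(mulr0 (ln c)).
  by apply: cvgB; [exact: cvg_cst | apply: cvgM => //; exact: cvg_cst].
(* The minus sign reverses the order: the upper bound [b / p ^+ n] gives the lower function of the
   squeeze. *)
apply: (squeeze_cvgr _ (lim b) (lim a)); near=> p.
have p1 : 1 < p by near: p; exact: nbhs_pinfty_gt.
have p0 : 0 < p by rewrite (lt_trans _ p1).
have lp0 : 0 < ln p by rewrite ln_gt0.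
have /andP[aP Pb] : a / p ^+ n <= Pout p <= b / p ^+ n by near: p.
have pn0 : 0 < p ^+ n by rewrite exprn_gt0.
have P0 : 0 < Pout p by rewrite (lt_le_trans _ aP)// divr_gt0.
have lnE (c : R) : 0 < c ->
    n%:R - ln c * (ln p)^-1 = - (ln (c / p ^+ n) / ln p).
  move=> c0; rewrite ln_div ?posrE// lnXn// -mulr_natl.
  by field; rewrite gt_eqF.
rewrite !lnE// !lerN2 !ler_pM2r ?invr_gt0//.
by rewrite !ler_ln ?posrE ?divr_gt0// Pb.
Unshelve. all: by end_near. Qed.

(** * Gaussian mass of small intervals and disks *)

Lemma normal_prob_sym_itv_bounds (R : realType) (s r : R) :
  s != 0 -> 0 < r <= 1 ->
  ((2 * r * normal_pdf 0 s 1)%:E <= normal_prob 0 s `[(- r)%R, r] /\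
   normal_prob 0 s `[(- r)%R, r] <= (2 * r * normal_peak s)%:E)%E.
Proof.
move=> s0 /andP[r0 r1].
have cstE (c : R) :
    (\int[lebesgue_measure]_(x in `[(- r)%R, r]) c%:E = (2 * r * c)%:E)%E.
  rewrite integral_cst//= lebesgue_measure_itv/= lte_fin gtrN//.
  by rewrite -EFinD -EFinM; congr EFin; ring.
(* Both bounds compare the density with a constant on [[-r, r]]: its value at [1] from below,
   because the centred density decreases in [x ^+ 2] and [x ^+ 2 <= 1] there, and its peak from
   above. *)
rewrite -!cstE; split; apply: ge0_le_integral => //=.
- by move=> x _; rewrite lee_fin normal_pdf_ge0.
- apply/measurable_EFinP; apply: measurable_funTS.
  exact: measurable_normal_pdf.
- move=> x; rewrite in_itv/= => /andP[rx xr].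
  rewrite lee_fin !normal_pdfE// ler_wpM2l ?normal_peak_ge0//.
  rewrite /normal_fun ler_expR.
  rewrite ler_pM2r ?invr_gt0 ?pmulrn_lgt0 ?exprn_even_gt0//.
  rewrite lerN2 !subr0 expr1n -real_normK ?num_real// expr_le1//.
  by rewrite ler_norml; lra.
- by move=> x _; rewrite lee_fin normal_pdf_ge0.
- apply/measurable_EFinP; apply: measurable_funTS.
  exact: measurable_normal_pdf.
- by move=> x _; rewrite lee_fin normal_pdf_ub.
Qed.

Lemma sqmod_cplane (R : realType) (d : measure_display)
    (T : measurableType d) (h : T -> R[i]) (w : T) :
  sqmod (h w) = (cplane h w).1 ^+ 2 + (cplane h w).2 ^+ 2.
Proof.
rewrite /sqmod /cplane /=; case: (h w) => x y /=.
by rewrite sqr_sqrtr// addr_ge0 ?sqr_ge0.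
Qed.

Lemma measurable_sqr_norm (R : realType) :
  measurable_fun setT (fun z : R * R => z.1 ^+ 2 + z.2 ^+ 2).
Proof.
by apply: measurable_funD; apply: measurable_funX;
  [exact: measurable_fst | exact: measurable_snd].
Qed.

(** Here [x] is the squared radius. The near user's outage negates strict inequalities and so leads
    to closed disks; the far user's is a strict inequality and leads to open ones. *)
Definition cdisk (R : realType) (x : R) : set (R * R) :=
  [set z | z.1 ^+ 2 + z.2 ^+ 2 <= x].

Definition odisk (R : realType) (x : R) : set (R * R) :=
  [set z | z.1 ^+ 2 + z.2 ^+ 2 < x].

Lemma measurable_cdisk (R : realType) (x : R) : measurable (cdisk R x).
Proof.
have mD := measurable_fun_ler (measurable_sqr_norm R) (measurable_cst x).
by rewrite -[cdisk R x]setTI; exact: (mD measurableT [set true]).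
Qed.

Lemma measurable_odisk (R : realType) (x : R) : measurable (odisk R x).
Proof.
have mD := measurable_fun_ltr (measurable_sqr_norm R) (measurable_cst x).
by rewrite -[odisk R x]setTI; exact: (mD measurableT [set true]).
Qed.

Section Probabilities.
Context {d : measure_display} {T : measurableType d} {R : realType}.
Variable P : probability T R.

Lemma measurable_cplane_preimage (rho : R) (h : T -> R[i])
    (A : set (R * R)) :
  complex_gaussian P rho h -> measurable A -> measurable (cplane h @^-1` A).
Proof. by move=> [mh _] mA; rewrite -[X in measurable X]setTI; exact: mh. Qed.

(* Sandwiching the disk of radius sqrt x between the concentric squares of
   half-sides sqrt x / 2 and sqrt x reduces to one-dimensional intervals. *)
Lemma complex_gaussian_disk_bounds (rho : R) (h : T -> R[i]) :
  0 < rho -> complex_gaussian P rho h ->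
  exists a b, [/\ 0 < a, 0 < b & forall x (A : set (R * R)), 0 < x <= 1 ->
    measurable A -> odisk R x `<=` A -> A `<=` cdisk R x ->
    a * x <= fine (P (cplane h @^-1` A)) <= b * x].
Proof.
move=> rho0 hCN; set s := Num.sqrt (rho / 2).
have s0 : s != 0 by rewrite gt_eqF// sqrtr_gt0 divr_gt0.
set m := normal_pdf 0 s 1; set M := normal_peak s.
have m0 : 0 < m by rewrite /m normal_pdfE// mulr_gt0 ?normal_peak_gt0 ?expR_gt0.
have M0 : 0 < M by exact: normal_peak_gt0.
(* These are the squares of the one-dimensional bounds: [(2 * (Num.sqrt x / 2) * m) ^+ 2] for the
   inner square and [(2 * Num.sqrt x * M) ^+ 2] for the outer one. *)
exists (m ^+ 2), (4 * M ^+ 2); split; rewrite ?mulr_gt0 ?exprn_gt0//.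
move=> x A /andP[x0 x1] mA oA Ac.
have mh B : measurable B -> measurable (cplane h @^-1` B).
  by move=> mB; exact: measurable_cplane_preimage hCN mB.
have [_ hP] := hCN; pose mu B := P (cplane h @^-1` B).
rewrite -/(mu A).
pose sq (r : R) : set (R * R) := `[- r, r] `*` `[- r, r].
have msq r : measurable (sq r) by exact: measurableX.
have muE r : mu (sq r) =
    (normal_prob 0 s `[(- r)%R, r] * normal_prob 0 s `[(- r)%R, r])%E.
  rewrite /mu hP//; exact: product_measure1E.
have sx0 : 0 < Num.sqrt x by rewrite sqrtr_gt0.
have sx1 : Num.sqrt x <= 1 by rewrite -sqrtr1 ler_sqrt.
have sxE : Num.sqrt x ^+ 2 = x by rewrite sqr_sqrtr// ltW.
(* On the inner square [u ^+ 2 + v ^+ 2 <= x / 2 < x], so it fits even in the open disk. *)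
have sqA : sq (Num.sqrt x / 2) `<=` A.
  move=> -[u v] [] /=; rewrite !in_itv/= => /andP[u1 u2] /andP[v1 v2].
  apply: oA => /=; rewrite /odisk/= -sxE; set r := Num.sqrt x.
  have ur : 0 <= (r / 2 - u) * (r / 2 + u) by apply: mulr_ge0; rewrite /r; lra.
  have vr : 0 <= (r / 2 - v) * (r / 2 + v) by apply: mulr_ge0; rewrite /r; lra.
  have r2 : 0 < r ^+ 2 by rewrite exprn_gt0.
  nra.
have Asq : A `<=` sq (Num.sqrt x).
  move=> -[u v] /Ac /=; rewrite /cdisk/= -{1}sxE => uv.
  split => /=; rewrite in_itv/= -ler_norml -ler_sqr ?nnegrE ?(ltW sx0)//
    real_normK ?num_real// (le_trans _ uv)// ?lerDl ?lerDr sqr_ge0//.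
have lo : ((m ^+ 2 * x)%:E <= mu A)%E.
  apply: (@le_trans _ _ (mu (sq (Num.sqrt x / 2)))); last first.
    apply: le_measure; rewrite ?inE; [exact: mh | exact: mh |].
    exact: preimage_subset.
  have [|l _] := @normal_prob_sym_itv_bounds R s (Num.sqrt x / 2) s0; first lra.
  rewrite muE (_ : m ^+ 2 * x =
    (2 * (Num.sqrt x / 2) * m) * (2 * (Num.sqrt x / 2) * m)).
    by rewrite EFinM lee_pmul// lee_fin; nra.
  by rewrite -[in LHS]sxE; field.
have up : (mu A <= (4 * M ^+ 2 * x)%:E)%E.
  apply: (@le_trans _ _ (mu (sq (Num.sqrt x)))).
    apply: le_measure; rewrite ?inE; [exact: mh | exact: mh |].
    exact: preimage_subset.
  have [|_ l] := @normal_prob_sym_itv_bounds R s (Num.sqrt x) s0; first lra.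
  rewrite muE (_ : 4 * M ^+ 2 * x =
    (2 * Num.sqrt x * M) * (2 * Num.sqrt x * M)).
    by rewrite EFinM lee_pmul.
  by rewrite -[in LHS]sxE; ring.
rewrite -!lee_fin fineK ?fin_num_measure//; last exact: mh.
by rewrite lo up.
Qed.

End Probabilities.

(** * Outage conditions as cutoffs on the channel gains *)

Lemma sqmod_ge0 (R : realType) (z : R[i]) : 0 <= sqmod z.
Proof. exact: sqr_ge0. Qed.

Lemma normc_ge0 (R : realType) (z : R[i]) : 0 <= Normc.normc z.
Proof. by case: z => x y; exact: sqrtr_ge0. Qed.

Lemma sqmod_max (R : realType) (z z1 z2 : R[i]) :
  Normc.normc z = Num.max (Normc.normc z1) (Normc.normc z2) ->
  sqmod z = Num.max (sqmod z1) (sqmod z2).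
Proof.
move=> zE; rewrite /sqmod zE.
by case: (leP (Normc.normc z1) (Normc.normc z2)) => l;
  [rewrite max_r | rewrite max_l]; rewrite // ler_sqr ?nnegrE ?normc_ge0// ltW.
Qed.

Lemma sqmod_min (R : realType) (z z1 z2 : R[i]) :
  Normc.normc z = Num.min (Normc.normc z1) (Normc.normc z2) ->
  sqmod z = Num.min (sqmod z1) (sqmod z2).
Proof.
move=> zE; rewrite /sqmod zE.
by case: (leP (Normc.normc z1) (Normc.normc z2)) => l;
  [rewrite min_l | rewrite min_r]; rewrite // ler_sqr ?nnegrE ?normc_ge0// ltW.
Qed.

Section Thresholds.
Context {R : realType}.
Variables k m sigma2 aN aF : R.
Hypotheses (k_gt0 : 0 < k) (m_gt0 : 0 < m) (sigma2_gt0 : 0 < sigma2)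
  (aN_gt0 : 0 < aN).

(** The SINR equals [th] at the squared gain [sinr_cutoff th / p]. *)
Definition sinr_cutoff (th : R) : R :=
  th * (k * sigma2) / (m * (aF - th * aN)).

Definition snr_cutoff (th : R) : R := th * (k * sigma2) / (m * aN).

Lemma sinr_cutoff_gt0 (th : R) : 0 < th -> th * aN < aF -> 0 < sinr_cutoff th.
Proof. by move=> th0 thF; rewrite divr_gt0 ?mulr_gt0// subr_gt0. Qed.

Let sinr_denom_gt0 (p : R) (z : R[i]) : 0 < p ->
  0 < k * sigma2 + m * p * sqmod z * aN.
Proof.
move=> p0; rewrite ltr_wpDr ?mulr_gt0//.
by rewrite mulr_ge0 ?(ltW aN_gt0)// mulr_ge0 ?sqmod_ge0// mulr_ge0 ?ltW.
Qed.

(** At high power the SINR of a nonzero channel tends to [aF / aN]. The condition [th * aN < aF]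
    puts the threshold below this limit and makes the cutoff's denominator positive, so clearing
    denominators preserves the inequality. *)
Lemma sinr_gt (th p : R) (z : R[i]) : th * aN < aF -> 0 < p ->
  (th < gamma_sic k m sigma2 aN aF p z) = (sinr_cutoff th / p < sqmod z).
Proof.
move=> thF p0; rewrite /gamma_sic /sinr_cutoff ltr_pdivlMr ?sinr_denom_gt0//.
rewrite ltr_pdivrMr// ltr_pdivrMr ?mulr_gt0 ?subr_gt0//.
(* Once denominators are cleared, both inequalities assert positivity of the same polynomial. *)
by rewrite -subr_gt0 -[RHS]subr_gt0; congr (0 < _); ring.
Qed.

Lemma sinr_lt (th p : R) (z : R[i]) : th * aN < aF -> 0 < p ->
  (gamma_F k m sigma2 aN aF p z < th) = (sqmod z < sinr_cutoff th / p).
Proof.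
move=> thF p0; rewrite /gamma_F /sinr_cutoff ltr_pdivrMr ?sinr_denom_gt0//.
rewrite ltr_pdivlMr// ltr_pdivlMr ?mulr_gt0 ?subr_gt0//.
by rewrite -subr_gt0 -[RHS]subr_gt0; congr (0 < _); ring.
Qed.

Lemma snr_gt (th p : R) (z : R[i]) : 0 < p ->
  (th < gamma_N k m sigma2 aN p z) = (snr_cutoff th / p < sqmod z).
Proof.
move=> p0; rewrite /gamma_N /snr_cutoff ltr_pdivlMr ?mulr_gt0//.
rewrite ltr_pdivrMr// ltr_pdivrMr ?mulr_gt0//.
by rewrite -subr_gt0 -[RHS]subr_gt0; congr (0 < _); ring.
Qed.

End Thresholds.

Lemma threshold_gt0 (R : realType) (k rate : R) :
  0 < k -> 0 < rate -> 0 < threshold k rate.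
Proof.
move=> k0 r0; rewrite /threshold subr_gt0 /powR pnatr_eq0/= expR_gt1.
by rewrite mulr_gt0 ?divr_gt0// ln_gt0// ltr1n.
Qed.

(** * Outage events and the two diversity orders *)

Section Outage.
Context {R : realType} {d : measure_display} {T : measurableType d}.
Variable P : probability T R.
Variables (h1 h2 hN hF : T -> R[i]) (rho1 rho2 k m sigma2 aN aF RN RF : R).
Hypotheses (rho1_gt0 : 0 < rho1) (rho2_gt0 : 0 < rho2).
Hypotheses (h1_CN : complex_gaussian P rho1 h1)
  (h2_CN : complex_gaussian P rho2 h2).
Hypotheses (k_gt0 : 0 < k) (m_gt0 : 0 < m) (sigma2_gt0 : 0 < sigma2)
  (aN_gt0 : 0 < aN).
Hypotheses (RF_gt0 : 0 < RF) (aF_gt : threshold k RF * aN < aF).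

Let cF : R := sinr_cutoff k m sigma2 aN aF (threshold k RF).
(** The near user must decode the far user's signal and then its own, so its gain has to pass the
    larger of the two cutoffs. *)
Let c : R := Num.max cF (snr_cutoff k m sigma2 aN (threshold k RN)).

Let cF_gt0 : 0 < cF.
Proof. by rewrite sinr_cutoff_gt0// threshold_gt0. Qed.

Let c_gt0 : 0 < c.
Proof. by rewrite lt_max cF_gt0. Qed.

Lemma outage_nearE (p : R) :
    (forall w, Normc.normc (hN w) =
      Num.max (Normc.normc (h1 w)) (Normc.normc (h2 w))) ->
    independent P h1 h2 -> 0 < p ->
  outage_near P k m sigma2 aN aF RN RF hN p =
  fine (P (cplane h1 @^-1` cdisk R (c / p))) *
  fine (P (cplane h2 @^-1` cdisk R (c / p))).
Proof.
move=> hN_max h12 p0; rewrite /outage_near.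
have mD := measurable_cdisk R (c / p).
have m1 := measurable_cplane_preimage _ _ _ _ h1_CN mD.
have m2 := measurable_cplane_preimage _ _ _ _ h2_CN mD.
set D1 := cplane h1 @^-1` _; set D2 := cplane h2 @^-1` _.
(* Division by [p > 0] commutes with the maximum, so the two conditions merge into one comparison
   with [c / p]. The larger gain fails it exactly when both gains do. *)
rewrite (_ : [set w | _] = ~` (D1 `&` D2)); last first.
  apply/funext => w; rewrite /D1 /D2 /cdisk /setI /setC /= -!sqmod_cplane.
  rewrite sinr_gt// snr_gt// -/cF.
  rewrite (propext (rwP andP)) -gt_max -maxr_pMl ?invr_ge0 ?(ltW p0)// -/c.
  rewrite (sqmod_max _ _ _ _ (hN_max w)) ltNge ge_max (propext (rwP andP)).
  by apply/propext; split => /negP.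
rewrite probability_setC; last exact: measurableI.
rewrite h12// fineB ?fin_num_measure//; last first.
  by rewrite fin_numM ?fin_num_measure.
by rewrite fineM ?fin_num_measure//= subKr.
Qed.

Lemma near_user_diversity_order :
    (forall w, Normc.normc (hN w) =
      Num.max (Normc.normc (h1 w)) (Normc.normc (h2 w))) ->
    independent P h1 h2 ->
  has_diversity_order (outage_near P k m sigma2 aN aF RN RF hN) 2.
Proof.
move=> hN_max h12.
have [a1 [b1 [a1_gt0 b1_gt0 h1b]]] :=
  complex_gaussian_disk_bounds _ _ _ rho1_gt0 h1_CN.
have [a2 [b2 [a2_gt0 b2_gt0 h2b]]] :=
  complex_gaussian_disk_bounds _ _ _ rho2_gt0 h2_CN.
(* The constants come from multiplying the disk bounds of [h1] and [h2], each taken at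
   [x = c / p]. *)
apply: (@diversity_order_squeeze _ _ 2 (a1 * a2 * c ^+ 2) (b1 * b2 * c ^+ 2));
  rewrite ?mulr_gt0 ?exprn_gt0//.
near=> p.
have p0 : 0 < p by near: p; exact: nbhs_pinfty_gt.
(* The disk bounds hold only for [x <= 1], that is, once [p >= c]. *)
have cp : 0 < c / p <= 1.
  rewrite divr_gt0// ler_pdivrMr// mul1r.
  by near: p; apply: nbhs_pinfty_ge; exact: num_real.
have oc : odisk R (c / p) `<=` cdisk R (c / p) by move=> z /ltW.
have /andP[l1 u1] := h1b _ _ cp (measurable_cdisk R _) oc (fun _ => id).
have /andP[l2 u2] := h2b _ _ cp (measurable_cdisk R _) oc (fun _ => id).
have [cp0 _] := andP cp.
rewrite outage_nearE//.
rewrite (_ : a1 * a2 * c ^+ 2 / p ^+ 2 = a1 * (c / p) * (a2 * (c / p)));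
  last by field; rewrite gt_eqF.
rewrite (_ : b1 * b2 * c ^+ 2 / p ^+ 2 = b1 * (c / p) * (b2 * (c / p)));
  last by field; rewrite gt_eqF.
by rewrite !ler_pM// ?fine_ge0// mulr_ge0 ?ltW.
Unshelve. all: by end_near. Qed.

Lemma outage_farE (p : R) :
    (forall w, Normc.normc (hF w) =
      Num.min (Normc.normc (h1 w)) (Normc.normc (h2 w))) -> 0 < p ->
  outage_far P k m sigma2 aN aF RF hF p =
  fine (P (cplane h1 @^-1` odisk R (cF / p) `|`
           cplane h2 @^-1` odisk R (cF / p))).
Proof.
move=> hF_min p0; rewrite /outage_far; congr (fine (P _)).
apply/funext => w; rewrite /odisk /setU /= -!sqmod_cplane.
rewrite sinr_lt// (sqmod_min _ _ _ _ (hF_min w)) gt_min.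
by apply/propext; split => /orP.
Qed.

Lemma far_user_diversity_order :
    (forall w, Normc.normc (hF w) =
      Num.min (Normc.normc (h1 w)) (Normc.normc (h2 w))) ->
  has_diversity_order (outage_far P k m sigma2 aN aF RF hF) 1.
Proof.
move=> hF_min.
have [a1 [b1 [a1_gt0 b1_gt0 h1b]]] :=
  complex_gaussian_disk_bounds _ _ _ rho1_gt0 h1_CN.
have [a2 [b2 [a2_gt0 b2_gt0 h2b]]] :=
  complex_gaussian_disk_bounds _ _ _ rho2_gt0 h2_CN.
(* The lower constant keeps only the event that [h1] fades; the upper one comes from the union bound
   over [h1] and [h2]. *)
apply: (@diversity_order_squeeze _ _ 1 (a1 * cF) ((b1 + b2) * cF));
  [exact: mulr_gt0 | by apply: mulr_gt0 => //; exact: addr_gt0 |].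
near=> p.
have p0 : 0 < p by near: p; exact: nbhs_pinfty_gt.
have cp : 0 < cF / p <= 1.
  rewrite divr_gt0// ler_pdivrMr// mul1r.
  by near: p; apply: nbhs_pinfty_ge; exact: num_real.
have oc : odisk R (cF / p) `<=` cdisk R (cF / p) by move=> z /ltW.
have mD := measurable_odisk R (cF / p).
have /andP[l1 u1] := h1b _ _ cp mD (fun _ => id) oc.
have /andP[l2 u2] := h2b _ _ cp mD (fun _ => id) oc.
have m1 := measurable_cplane_preimage _ _ _ _ h1_CN mD.
have m2 := measurable_cplane_preimage _ _ _ _ h2_CN mD.
have mU := measurableU _ _ m1 m2.
rewrite outage_farE// expr1 -(mulrA a1) -(mulrA (b1 + b2)); apply/andP; split.
  apply: (le_trans l1); apply: fine_le; rewrite ?fin_num_measure//.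
  by apply: le_measure; rewrite ?inE//; exact: subsetUl.
apply: (@le_trans _ _ (fine (P (cplane h1 @^-1` odisk R (cF / p))) +
                       fine (P (cplane h2 @^-1` odisk R (cF / p))))).
  rewrite -fineD ?fin_num_measure//; apply: fine_le => //.
  - by rewrite fin_num_measure.
  - by rewrite fin_numD !fin_num_measure.
  - exact: measureU2.
by rewrite mulrDl lerD.
Unshelve. all: by end_near. Qed.

End Outage.

Local Close Scope classical_set_scope.

Theorem mainTheorem2 (R : realType) (d : measure_display)
    (T : measurableType d) (P : probability T R)
    (h1 h2 hN hF : T -> R[i])
    (rho1 rho2 sigma2 aN aF kappa mu RN RF : R) (t : scheme)
    (rho1_gt0 : 0 < rho1) (rho2_gt0 : 0 < rho2)
    (h1_CN : complex_gaussian P rho1 h1)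
    (h2_CN : complex_gaussian P rho2 h2)
    (h12_indep : independent P h1 h2)
    (hN_max : forall w, Normc.normc (hN w) =
       Num.max (Normc.normc (h1 w)) (Normc.normc (h2 w)))
    (hF_min : forall w, Normc.normc (hF w) =
       Num.min (Normc.normc (h1 w)) (Normc.normc (h2 w)))
    (sigma2_gt0 : 0 < sigma2)
    (aN_gt0 : 0 < aN) (aND : aN + aF = 1) (aN_lt_aF : aN < aF)
    (kappa_ge0 : 0 <= kappa) (kappa_le1 : kappa <= 1)
    (mu_ge0 : 0 <= mu) (mu_le1 : mu <= 1)
    (kappat_gt0 : 0 < bandwidth t kappa) (mut_gt0 : 0 < power t mu)
    (RN_ge0 : 0 <= RN) (RF_gt0 : 0 < RF)
    (aF_gt : aF > threshold (bandwidth t kappa) RF * aN) :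
  has_diversity_order
    (outage_near P (bandwidth t kappa) (power t mu) sigma2 aN aF RN RF hN) 2
  /\
  has_diversity_order
    (outage_far P (bandwidth t kappa) (power t mu) sigma2 aN aF RF hF) 1.
Proof.
split.
  exact: near_user_diversity_order rho1_gt0 rho2_gt0 h1_CN h2_CN
    _ _ _ _ _ _ _ _.
exact: far_user_diversity_order rho1_gt0 rho2_gt0 h1_CN h2_CN _ _ _ _ _ _ _.
Qed.
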